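(* Let $B\subseteq\mathbb{B}$ be a connected set, let $\mathbf{f}:B\to\mathbb{B}$ be *analytic on $B$, and let $C$ be a contour in $B$ with initial point $\mathbf{z}_1$ and end point $\mathbf{z}_2$. Then $$\int_C \mathbf{f}^*(\mathbf{z})^{d\mathbf{z}}=\frac{\mathbf{f}(\mathbf{z}_2)}{\mathbf{f}(\mathbf{z}_1)}.$$
   Context: Let $\mathbb{B}=\{(r,\theta): r>0,\ -\infty<\theta<\infty\}$, regarded as $(0,\infty)\times\mathbb{R}$ with its usual topology. Multiplication and division on $\mathbb{B}$ are $(r_1,\theta_1)(r_2,\theta_2)=(r_1r_2,\theta_1+\theta_2)$ and $(r_1,\theta_1)/(r_2,\theta_2)=(r_1/r_2,\theta_1-\theta_2)$. The exponential $\mathbb{C}\to\mathbb{B}$ is $\mathbf{e}^{z}=(e^x,y)$ for $z=x+iy$. A function $\mathbf{f}:B\subseteq\mathbb{B}\to\mathbb{B}$ is written $\mathbf{f}(r,\theta)=(R(r,\theta),\Theta(r,\theta))$, with $R>0$ and $\Theta$ real-valued; $(\cdot)'_r$ and $(\cdot)'_\theta$ denote partial derivatives. *Derivative: $\mathbf{f}$ is *differentiable at $(r,\theta)$ if $R$ and $\Theta$ have continuous partial derivatives and the Cauchy--Riemann conditions $r(\ln R)'_r=\Theta'_\theta$ and $r\Theta'_r=-(\ln R)'_\theta$ hold at $(r,\theta)$ (this presupposes that $\mathbf{f}$ is defined in a neighbourhood of $(r,\theta)$). Its *derivative at $\mathbf{z}=(r,\theta)$ is then $$\mathbf{f}^*(\mathbf{z})=\big(e^{(\ln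 R)'_r\cos\theta+\Theta'_r\sin\theta},\ \Theta'_r\cos\theta-(\ln R)'_r\sin\theta\big)\in\mathbb{B}.$$ $\mathbf{f}$ is *analytic on $B$ if it is *differentiable at every point of $B$. *Integral: let $\mathbf{g}:B\to\mathbb{B}$, $\mathbf{g}(r,\theta)=(S(r,\theta),\Psi(r,\theta))$, and let $C$ be a contour in $B$ (in the usual sense, a piecewise smooth path) with parameterization $\mathbf{z}(t)=(r(t),\theta(t))$, $a\le t\le b$; its initial and end points are $\mathbf{z}(a)$ and $\mathbf{z}(b)$. The *integral of $\mathbf{g}$ along $C$ is $$\int_C\mathbf{g}(\mathbf{z})^{d\mathbf{z}}=\mathbf{e}^{\int_C P\,dr-Q\,d\theta+i\int_C M\,dr+N\,d\theta},$$ assuming that the ordinary line integrals on the right exist, where $P=\ln S\cos\theta-\Psi\sin\theta$, $Q=r\ln S\sin\theta+r\Psi\cos\theta$, $M=\ln S\sin\theta+\Psi\cos\theta$, $N=r\ln S\cos\theta-r\Psi\sin\theta$. *)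

(* Defs.v *)
From Stdlib Require Import Reals.
From Coquelicot Require Import Coquelicot.
Open Scope R_scope.

(* Points (r, theta) of BB are pairs of reals with r > 0.  Maps between subsets
   of BB are total functions on R * R; their values outside the subset are
   irrelevant.  As BB is open in R * R, its topology is the one inherited from
   the product topology. *)
Definition BB (w : R * R) : Prop := 0 < fst w.

Definition bdiv (w1 w2 : R * R) : R * R := (fst w1 / fst w2, snd w1 - snd w2).

Definition bexp (w : C) : R * R := (exp (Re w), Im w).

Definition connected_set (B : R * R -> Prop) : Prop :=
  forall U V : R * R -> Prop,
    open U -> open V ->
    (forall w, B w -> U w \/ V w) ->
    (exists w, B w /\ U w) -> (exists w, B w /\ V w) ->
    exists w, B w /\ U w /\ V w.

Definition pd_r (F : R * R -> R) (w : R * R) : R :=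
  Derive (fun s => F (s, snd w)) (fst w).

Definition pd_theta (F : R * R -> R) (w : R * R) : R :=
  Derive (fun s => F (fst w, s)) (snd w).

(* The partial derivatives exist in a neighbourhood of w and are continuous
   at w. *)
Definition continuous_partials (F : R * R -> R) (w : R * R) : Prop :=
  locally w (fun v => ex_derive (fun s => F (s, snd v)) (fst v) /\
                      ex_derive (fun s => F (fst v, s)) (snd v)) /\
  continuous (pd_r F) w /\ continuous (pd_theta F) w.

Definition modulus (f : R * R -> R * R) (w : R * R) : R := fst (f w).
Definition angle (f : R * R -> R * R) (w : R * R) : R := snd (f w).
Definition ln_modulus (f : R * R -> R * R) (w : R * R) : R := ln (modulus f w).

Definition star_differentiable (B : R * R -> Prop) (f : R * R -> R * R)
    (w : R * R) : Prop :=
  locally w B /\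
  continuous_partials (modulus f) w /\
  continuous_partials (angle f) w /\
  fst w * pd_r (ln_modulus f) w = pd_theta (angle f) w /\
  fst w * pd_r (angle f) w = - pd_theta (ln_modulus f) w.

Definition star_derive (f : R * R -> R * R) (w : R * R) : R * R :=
  (exp (pd_r (ln_modulus f) w * cos (snd w) + pd_r (angle f) w * sin (snd w)),
   pd_r (angle f) w * cos (snd w) - pd_r (ln_modulus f) w * sin (snd w)).

Definition star_analytic (B : R * R -> Prop) (f : R * R -> R * R) : Prop :=
  forall w, B w -> star_differentiable B f w.

(* z is continuously differentiable on [c, d], with one-sided derivatives at
   the end points: only the values of z on [c, d] matter. *)
Definition smooth_arc (z : R -> R * R) (c d : R) : Prop :=
  exists dz : R -> R * R,
    forall t, c <= t <= d ->
      filterdiff z (within (fun s => c <= s <= d) (locally t))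
        (fun h => scal h (dz t)) /\
      filterlim dz (within (fun s => c <= s <= d) (locally t))
        (locally (dz t)).

Definition contour_in (B : R * R -> Prop) (z : R -> R * R) (a b : R) : Prop :=
  a < b /\
  (forall t, a <= t <= b -> B (z t)) /\
  exists (n : nat) (x : nat -> R),
    x O = a /\ x n = b /\
    forall i, (i < n)%nat -> x i < x (S i) /\ smooth_arc z (x i) (x (S i)).

(* The line integral of F dr + G dtheta along z exists and equals l.  Along a
   contour, Derive is the derivative of the path except at the finitely many
   subdivision points; its values there do not affect the integral. *)
Definition is_line_integral (F G : R * R -> R) (z : R -> R * R) (a b l : R)
    : Prop :=
  is_RInt (fun t => F (z t) * Derive (fun s => fst (z s)) t +
                    G (z t) * Derive (fun s => snd (z s)) t) a b l.

Definition coefP (g : R * R -> R * R) (w : R * R) : R :=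
  ln_modulus g w * cos (snd w) - angle g w * sin (snd w).
Definition coefQ (g : R * R -> R * R) (w : R * R) : R :=
  fst w * ln_modulus g w * sin (snd w) + fst w * angle g w * cos (snd w).
Definition coefM (g : R * R -> R * R) (w : R * R) : R :=
  ln_modulus g w * sin (snd w) + angle g w * cos (snd w).
Definition coefN (g : R * R -> R * R) (w : R * R) : R :=
  fst w * ln_modulus g w * cos (snd w) - fst w * angle g w * sin (snd w).

(* The *integral of g along z exists and equals w. *)
Definition is_star_integral (g : R * R -> R * R) (z : R -> R * R) (a b : R)
    (w : R * R) : Prop :=
  exists I J : R,
    is_line_integral (coefP g) (fun v => - coefQ g v) z a b I /\
    is_line_integral (coefM g) (coefN g) z a b J /\
    w = bexp (RtoC I + Ci * RtoC J)%C.

(* Main.v *)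
Require Import Defs.
From Stdlib Require Import Reals Lra Lia.
From Coquelicot Require Import Coquelicot.
Open Scope R_scope.

(** The trigonometric factors in the *derivative cancel those in the line
    integrals: for [g = f^*] one finds [P = (ln R)'_r] and [M = Theta'_r], and
    the Cauchy-Riemann conditions turn [-Q] and [N] into [(ln R)'_theta] and
    [Theta'_theta].  So the two line integrals are those of the exact forms
    [d(ln R)] and [d Theta], which are evaluated arc by arc with the chain rule
    and the fundamental theorem of calculus. *)

(** This retraction of the line onto [[c, d]] extends data known only on [[c, d]] constantly beyond
    the end points, so that one-sided continuity becomes continuity everywhere. *)
Definition clamp (c d t : R) : R := Rmax c (Rmin d t).

Lemma clamp_bounds c d t : c <= d -> c <= clamp c d t <= d.
Proof.
  intros cd; unfold clamp; split.
  - apply Rmax_l.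
  - apply Rmax_lub; [exact cd | apply Rmin_l].
Qed.

Lemma clamp_id c d t : c <= t <= d -> clamp c d t = t.
Proof.
  intros ctd; unfold clamp.
  rewrite Rmin_right by lra; apply Rmax_right; lra.
Qed.

Lemma clamp_lipschitz c d s t : Rabs (clamp c d s - clamp c d t) <= Rabs (s - t).
Proof.
  unfold clamp, Rmax, Rmin, Rabs.
  repeat destruct Rle_dec; repeat destruct Rcase_abs; lra.
Qed.

(** Clamping does not increase distances and lands in [[c, d]], so the radius that works relative to
    [[c, d]] works unchanged on the line. *)
Lemma continuous_clamp_comp {V : UniformSpace} (g : R -> V) c d t :
  c <= d ->
  filterlim g (within (fun s => c <= s <= d) (locally (clamp c d t)))
    (locally (g (clamp c d t))) ->
  continuous (fun s => g (clamp c d s)) t.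
Proof.
  intros cd g_lim P HP.
  destruct (g_lim P HP) as [eps Heps].
  exists eps; intros s s_t.
  apply Heps; [| now apply clamp_bounds].
  apply Rle_lt_trans with (2 := s_t), clamp_lipschitz.
Qed.

Lemma within_is_filter_lim {T : UniformSpace} (D : T -> Prop) (x : T) :
  is_filter_lim (within D (locally x)) x.
Proof. intros P HP; now apply filter_le_within. Qed.

Lemma filterdiff_within_interior {U V : NormedModule R_AbsRing}
    (D : U -> Prop) (f l : U -> V) (x : U) :
  locally x D -> filterdiff f (within D (locally x)) l ->
  filterdiff f (locally x) l.
Proof.
  intros Dx [l_lin f_dom]; split; [exact l_lin |].
  (* [filterdiff] asks for the estimate at every limit of the filter; [locally x] has only the limit
     [x]. *)
  intros y xy; apply is_filter_lim_locally_unique in xy; subst y.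
  intros eps.
  generalize (filter_and _ _ Dx (f_dom x (within_is_filter_lim D x) eps)).
  apply filter_imp; intros y [Dy Hy]; exact (Hy Dy).
Qed.

(* At [c] and [d] only one-sided information on [h] is available, so a primitive
   of the clamped [k] is compared with the clamped [h] by the mean value theorem,
   which needs derivatives in the open interval only. *)
Lemma is_RInt_derive_interior (h k : R -> R) (c d : R) :
  c <= d ->
  (forall t, c < t < d -> is_derive h t (k t)) ->
  (forall t, continuous (fun s => h (clamp c d s)) t) ->
  (forall t, continuous (fun s => k (clamp c d s)) t) ->
  is_RInt k c d (h d - h c).
Proof.
  intros cd h_der h_cont k_cont.
  set (kc := fun s => k (clamp c d s)).
  set (H := fun t => RInt kc c t).
  assert (H_int : forall t, is_RInt kc c t (H t)).
  { intros t; apply (RInt_correct (V := R_CompleteNormedModule)).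
    apply (ex_RInt_continuous (V := R_CompleteNormedModule)).
    intros s _; apply k_cont. }
  assert (H_der : forall t, is_derive H t (kc t)).
  { intros t; apply is_derive_RInt with c; [| apply k_cont].
    apply filter_forall, H_int. }
  assert (loc : forall t, c < t < d -> locally t (fun s => c <= s <= d)).
  { intros t ctd.
    generalize (locally_interval (fun s => c <= s <= d) t c d (proj1 ctd) (proj2 ctd)).
    intros L; apply L; intros y; simpl; lra. }
  (* With derivative 0 inside the interval, [E] says that the difference takes the same value at [c]
     and [d]. *)
  destruct (MVT_gen (fun t => H t - h (clamp c d t)) c d (fun _ => 0)) as [_ [_ E]].
  - rewrite Rmin_left, Rmax_right by exact cd; intros t ctd.
    replace 0 with (kc t - k t) by (unfold kc; rewrite clamp_id; lra).
    apply (is_derive_minus H); [apply H_der |].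
    apply is_derive_ext_loc with h; [| now apply h_der].
    generalize (loc t ctd); apply filter_imp; intros s csd.
    now rewrite clamp_id.
  - intros t _; apply continuity_pt_filterlim.
    apply (continuous_minus H (fun s => h (clamp c d s))); [| apply h_cont].
    apply (ex_derive_continuous H); eexists; apply H_der.
  - assert (H0 : H c = 0) by exact (RInt_point c kc).
    rewrite H0, !clamp_id in E by lra.
    replace (h d - h c) with (H d) by lra.
    apply is_RInt_ext with kc; [| apply H_int].
    rewrite Rmin_left, Rmax_right by exact cd.
    intros t ctd; unfold kc; rewrite clamp_id; [reflexivity | lra].
Qed.

(** By the chain rule the integrand is the derivative of [F] along the path, [A] and [B] being the
    components of the gradient of [F]. *)
Lemma is_line_integral_smooth_arc (F A B : R * R -> R) (z : R -> R * R) (c d : R) :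
  c <= d -> smooth_arc z c d ->
  (forall t, c <= t <= d ->
    filterdiff F (locally (z t)) (fun h => fst h * A (z t) + snd h * B (z t))) ->
  (forall t, c <= t <= d -> continuous A (z t)) ->
  (forall t, c <= t <= d -> continuous B (z t)) ->
  is_line_integral A B z c d (F (z d) - F (z c)).
Proof.
  intros cd [dz z_smooth] F_diff A_cont B_cont.
  assert (z_clamp : forall t, continuous (fun s => z (clamp c d s)) t).
  { intros t; apply continuous_clamp_comp; [exact cd |].
    refine (filterdiff_continuous_aux z _ _ (within_is_filter_lim _ _)).
    eexists; apply z_smooth; now apply clamp_bounds. }
  assert (dz_clamp : forall t, continuous (fun s => dz (clamp c d s)) t).
  { intros t; apply continuous_clamp_comp; [exact cd |].
    apply z_smooth; now apply clamp_bounds. }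
  assert (z_diff : forall t, c < t < d ->
            filterdiff z (locally t) (fun h => scal h (dz t))).
  { intros t ctd.
    apply filterdiff_within_interior with (fun s => c <= s <= d).
    - generalize (locally_interval (fun s => c <= s <= d) t c d (proj1 ctd) (proj2 ctd)).
      intros L; apply L; intros y; simpl; lra.
    - apply z_smooth; lra. }
  unfold is_line_integral.
  (* [Derive] is two-sided and may differ from [dz] at [c] and [d]. Agreement inside the interval is
     enough for the integral, and [dz] is continuous up to the end points. *)
  apply is_RInt_ext with
    (fun t => A (z t) * fst (dz t) + B (z t) * snd (dz t)).
  { rewrite Rmin_left, Rmax_right by exact cd; intros t ctd.
    assert (D1 : is_derive (fun s => fst (z s)) t (fst (dz t))).
    { apply (filterdiff_comp' z fst t _ fst (z_diff t ctd)).
      apply (filterdiff_linear fst), is_linear_fst. }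
    assert (D2 : is_derive (fun s => snd (z s)) t (snd (dz t))).
    { apply (filterdiff_comp' z snd t _ snd (z_diff t ctd)).
      apply (filterdiff_linear snd), is_linear_snd. }
    apply f_equal2; apply f_equal; symmetry; now apply is_derive_unique. }
  apply (is_RInt_derive_interior (fun t => F (z t))); [exact cd | | |].
  - intros t ctd; unfold is_derive.
    eapply filterdiff_ext_lin.
    + eapply (filterdiff_comp' z F t); [exact (z_diff t ctd) | apply F_diff; lra].
    + intros y; unfold scal; simpl; unfold prod_scal, scal; simpl.
      unfold mult; simpl; ring.
  - intros t; apply (continuous_comp (fun s => z (clamp c d s)) F); [apply z_clamp |].
    apply (filterdiff_continuous F); eexists; apply F_diff; now apply clamp_bounds.
  - intros t; apply (continuous_plus (V := R_NormedModule));
      apply (continuous_mult (K := R_AbsRing)).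
    + apply (continuous_comp (fun s => z (clamp c d s)) A); [apply z_clamp |].
      apply A_cont; now apply clamp_bounds.
    + apply (continuous_comp (fun s => dz (clamp c d s)) fst); [apply dz_clamp |].
      apply continuous_fst.
    + apply (continuous_comp (fun s => z (clamp c d s)) B); [apply z_clamp |].
      apply B_cont; now apply clamp_bounds.
    + apply (continuous_comp (fun s => dz (clamp c d s)) snd); [apply dz_clamp |].
      apply continuous_snd.
Qed.

Lemma subdivision_le (x : nat -> R) (n : nat) :
  (forall i, (i < n)%nat -> x i < x (S i)) -> x O <= x n.
Proof.
  induction n as [| n IH]; intros x_incr; [apply Rle_refl |].
  apply Rle_trans with (x n).
  - apply IH; intros i i_n; apply x_incr; lia.
  - apply Rlt_le, x_incr; lia.
Qed.

(** Induction on the number of arcs: the increments of [F] over consecutive arcs telescope. *)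
Lemma is_line_integral_contour (D : R * R -> Prop) (F A B : R * R -> R)
    (z : R -> R * R) (a b : R) :
  contour_in D z a b ->
  (forall w, D w ->
    filterdiff F (locally w) (fun h => fst h * A w + snd h * B w)) ->
  (forall w, D w -> continuous A w) ->
  (forall w, D w -> continuous B w) ->
  is_line_integral A B z a b (F (z b) - F (z a)).
Proof.
  intros [_ [z_in [n [x [xa [xb x_arc]]]]]] F_diff A_cont B_cont.
  subst a b.
  induction n as [| n IH].
  - rewrite Rminus_diag; exact (is_RInt_point _ _).
  - assert (x0n : x O <= x n).
    { apply subdivision_le; intros i i_n; apply x_arc; lia. }
    destruct (x_arc n) as [xnS arc]; [lia |].
    replace (F (z (x (S n))) - F (z (x O))) with
      (plus (F (z (x n)) - F (z (x O))) (F (z (x (S n))) - F (z (x n))))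
      by (unfold plus; simpl; ring).
    apply (is_RInt_Chasles (V := R_NormedModule)) with (x n).
    + apply IH.
      * intros t xt; apply z_in; lra.
      * intros i i_n; apply x_arc; lia.
    + apply is_line_integral_smooth_arc; [lra | exact arc | | |];
        intros t xt; [apply F_diff | apply A_cont | apply B_cont];
        apply z_in; lra.
Qed.

Lemma filterdiff_continuous_partials (F : R * R -> R) (w : R * R) :
  continuous_partials F w ->
  filterdiff F (locally w)
    (fun h => fst h * pd_r F w + snd h * pd_theta F w).
Proof.
  destruct w as [r th]; intros [F_ex [F_r _]].
  apply filterdiff_ext with (fun u => F (fst u, snd u)).
  { now intros [s t]. }
  apply (is_derive_filterdiff (fun s t => F (s, t)) r th
           (fun s t => pd_r F (s, t))).
  - generalize F_ex; apply filter_imp; intros [s t] [ex_r _].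
    now apply Derive_correct.
  - apply Derive_correct, (locally_singleton _ _ F_ex).
  - apply continuous_ext with (pd_r F); [now intros [s t] | exact F_r].
Qed.

(** Near [w] the partial derivatives of the logarithm are those of [F] divided by [F], and [F] is
    continuous at [w] because it is differentiable there. *)
Lemma continuous_partials_ln (F : R * R -> R) (w : R * R) :
  locally w (fun v => 0 < F v) -> continuous_partials F w ->
  continuous_partials (fun v => ln (F v)) w.
Proof.
  intros F_pos F_C1.
  assert (F_inv : continuous (fun v => / F v) w).
  { apply (continuous_comp F Rinv).
    - apply (filterdiff_continuous F).
      eexists; now apply filterdiff_continuous_partials.
    - apply continuous_Rinv.
      generalize (locally_singleton _ _ F_pos); lra. }
  destruct F_C1 as [F_ex [F_r F_th]].
  assert (ln_der : locally w (fun v =>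
    is_derive (fun s => ln (F (s, snd v))) (fst v) (pd_r F v * / F v) /\
    is_derive (fun s => ln (F (fst v, s))) (snd v) (pd_theta F v * / F v))).
  { generalize (filter_and _ _ F_pos F_ex); apply filter_imp.
    intros [r th] [pos [ex_r ex_th]]; simpl in *; split;
      apply (is_derive_comp ln); try (now apply is_derive_ln);
      now apply Derive_correct. }
  split; [| split].
  - generalize ln_der; apply filter_imp; intros v [D1 D2].
    split; eexists; eassumption.
  - apply continuous_ext_loc with (fun v => pd_r F v * / F v).
    + generalize ln_der; apply filter_imp; intros v [D1 _].
      symmetry; exact (is_derive_unique _ _ _ D1).
    + now apply (continuous_mult (K := R_AbsRing)).
  - apply continuous_ext_loc with (fun v => pd_theta F v * / F v).
    + generalize ln_der; apply filter_imp; intros v [_ D2].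
      symmetry; exact (is_derive_unique _ _ _ D2).
    + now apply (continuous_mult (K := R_AbsRing)).
Qed.

(** The coefficients are known to be partial derivatives on [D] only, so they are replaced inside
    the integrand, along the path; continuity is then required of the partial derivatives
    themselves. *)
Lemma is_line_integral_exact (D : R * R -> Prop) (F A B : R * R -> R)
    (z : R -> R * R) (a b : R) :
  contour_in D z a b ->
  (forall w, D w -> continuous_partials F w) ->
  (forall w, D w -> A w = pd_r F w /\ B w = pd_theta F w) ->
  is_line_integral A B z a b (F (z b) - F (z a)).
Proof.
  intros z_contour F_C1 AB.
  apply is_RInt_ext with
    (fun t => pd_r F (z t) * Derive (fun s => fst (z s)) t +
              pd_theta F (z t) * Derive (fun s => snd (z s)) t).
  - destruct z_contour as [ab [z_in _]].
    rewrite Rmin_left, Rmax_right by lra.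
    intros t t_ab; destruct (AB (z t)) as [-> ->]; [apply z_in; lra |].
    reflexivity.
  - apply (is_line_integral_contour D); [exact z_contour | | |];
      intros w Dw; [apply filterdiff_continuous_partials | |]; now apply F_C1.
Qed.

(** In complex form, [P + iM] is [ln S + i Psi] multiplied by [e^(i theta)], while the *derivative
    comes from [(ln R)'_r + i Theta'_r] multiplied by [e^(-i theta)]; the two rotations cancel. *)
Lemma coefPM_star_derive (f : R * R -> R * R) (w : R * R) :
  coefP (star_derive f) w = pd_r (ln_modulus f) w /\
  coefM (star_derive f) w = pd_r (angle f) w.
Proof.
  assert (L : ln_modulus (star_derive f) w =
    pd_r (ln_modulus f) w * cos (snd w) + pd_r (angle f) w * sin (snd w))
    by exact (ln_exp _).
  assert (A : angle (star_derive f) w =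
    pd_r (angle f) w * cos (snd w) - pd_r (ln_modulus f) w * sin (snd w))
    by reflexivity.
  unfold coefP, coefM; rewrite L, A.
  generalize (sin2_cos2 (snd w)); unfold Rsqr; intros E; split.
  - transitivity (pd_r (ln_modulus f) w *
      (sin (snd w) * sin (snd w) + cos (snd w) * cos (snd w))); [| rewrite E]; ring.
  - transitivity (pd_r (angle f) w *
      (sin (snd w) * sin (snd w) + cos (snd w) * cos (snd w))); [| rewrite E]; ring.
Qed.

(** For every [g] one has [Q = r M] and [N = r P], so the values of [P] and [M] turn the claim into
    the two Cauchy-Riemann conditions. *)
Lemma coefQN_star_derive (B : R * R -> Prop) (f : R * R -> R * R) (w : R * R) :
  star_differentiable B f w ->
  - coefQ (star_derive f) w = pd_theta (ln_modulus f) w /\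
  coefN (star_derive f) w = pd_theta (angle f) w.
Proof.
  intros [_ [_ [_ [CR1 CR2]]]].
  destruct (coefPM_star_derive f w) as [EP EM].
  split.
  - replace (coefQ (star_derive f) w) with (fst w * coefM (star_derive f) w)
      by (unfold coefQ, coefM; ring).
    rewrite EM, CR2; ring.
  - replace (coefN (star_derive f) w) with (fst w * coefP (star_derive f) w)
      by (unfold coefN, coefP; ring).
    rewrite EP; exact CR1.
Qed.

Theorem theorem1 (B : R * R -> Prop) (f : R * R -> R * R)
    (z : R -> R * R) (a b : R) (z1 z2 : R * R)
    (B_in_BB : forall w, B w -> BB w)
    (B_connected : connected_set B)
    (f_in_BB : forall w, B w -> BB (f w))
    (f_analytic : star_analytic B f)
    (C_contour : contour_in B z a b)
    (C_initial : z a = z1)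
    (C_end : z b = z2) :
  is_star_integral (star_derive f) z a b (bdiv (f z2) (f z1)).
Proof.
  subst z1 z2.
  exists (ln_modulus f (z b) - ln_modulus f (z a)).
  exists (angle f (z b) - angle f (z a)).
  split; [| split].
  - apply (is_line_integral_exact B); [exact C_contour | |]; intros w Bw;
      destruct (f_analytic w Bw) as [B_loc [R_C1 _]].
    + apply continuous_partials_ln; [| exact R_C1].
      (* [B] is a neighbourhood of [w], so the modulus of [f] is positive near [w] and not just at
         [w]. *)
      generalize B_loc; apply filter_imp; exact f_in_BB.
    + split; [apply coefPM_star_derive |].
      now apply (coefQN_star_derive B), f_analytic.
  - apply (is_line_integral_exact B); [exact C_contour | |]; intros w Bw.
    + apply (f_analytic w Bw).
    + split; [apply coefPM_star_derive |].
      now apply (coefQN_star_derive B), f_analytic.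
  - destruct C_contour as [ab [z_in _]].
    assert (pos_a : 0 < modulus f (z a)) by (apply f_in_BB, z_in; lra).
    assert (pos_b : 0 < modulus f (z b)) by (apply f_in_BB, z_in; lra).
    unfold bexp, bdiv; simpl; f_equal.
    (* The real part of [I + i J] still carries the vanishing terms of the complex product, which
       [ring] clears; the exponential then turns the difference of logarithms into the quotient of
       moduli. *)
    + match goal with |- _ = exp ?e =>
        replace e with (ln_modulus f (z b) + - ln_modulus f (z a)) by ring end.
      unfold ln_modulus; rewrite exp_plus, exp_Ropp, !exp_ln by assumption.
      reflexivity.
    + unfold angle; ring.
Qed.
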